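(* Let $p$ be a prime number, $(G,\circ)$ a group of size $p^k$ with $k\ge 1$, $\phi\in\mathrm{Sym}(G)$ and $\psi\in\mathrm{Aut}(G,\circ)$ such that $$\phi(\phi(y)\circ\psi(x))\circ\psi(\phi(y))=\phi(\phi(x)\circ\psi(y))\circ\psi(\phi(x))\qquad\text{for all }x,y\in G,$$ and suppose that every normal subgroup $H$ of $G$ with $1\neq H\neq G$ that is invariant under $\psi$ is not invariant under $\phi$. Then the pair $(X,\cdot)$ given by $X:=G$ and $x\cdot y:=\phi(x)\circ\psi(y)$ for all $x,y\in G$ is a non-trivial simple cycle set with $\mathrm{Dis}(X)\cong G$. Conversely, every finite simple cycle set $X$ with $|X|>1$ whose displacement group is nilpotent and acts regularly on $X$ can be constructed in this way (up to isomorphism).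
   Context: A left quasigroup $(X,\cdot)$ is a non-empty set with a binary operation such that $\sigma_x:y\mapsto x\cdot y$ is bijective for every $x$. A cycle set is a left quasigroup with $(x\cdot y)\cdot(x\cdot z)=(y\cdot x)\cdot(y\cdot z)$ for all $x,y,z$; all cycle sets are assumed non-degenerate, i.e. $x\mapsto x\cdot x$ is bijective. A trivial cycle set is one of the form $x\cdot y=\gamma(y)$ for a fixed permutation $\gamma$. $\mathcal{G}(X)=\langle\sigma_x\mid x\in X\rangle\le \mathrm{Sym}(X)$; $X$ is indecomposable if $\mathcal{G}(X)$ is transitive on $X$. The displacement group $\mathrm{Dis}(X)$ is the normal closure of $\{\sigma_x\sigma_y^{-1}\mid x,y\in X\}$ in $\mathcal{G}(X)$. A congruence is an equivalence relation $\sim$ such that $x\sim x'$ and $y\sim y'$ imply $x\cdot y\sim x'\cdot y'$ and $\sigma_x^{-1}(y)\sim\sigma_{x'}^{-1}(y')$. $X$ is simple if it is indecomposable and its only congruences are the equality relation and the all relation. A normal subgroup $H$ of $G$ is invariant under a map $f:G\to G$ if $x^{-1}y\in H$ implies $f(x)^{-1}f(y)\in H$ for all $x,y\in G$. *)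

(* Defs.v *)
From mathcomp Require Import all_boot all_fingroup all_solvable.

Set Implicit Arguments.
Unset Strict Implicit.
Unset Printing Implicit Defensive.

Local Open Scope group_scope.

Section CycleSets.

Variables (X : finType) (op : X -> X -> X).

Definition left_quasigroup : Prop :=
  (0 < #|X|)%N /\ forall x, bijective (op x).

(* Total definition: equal to 1 when [op x] is not bijective; see [sigmaE]. *)
Definition sigma (x : X) : {perm X} := insubd (1 : {perm X}) (finfun (op x)).

Lemma sigmaE : left_quasigroup -> forall x y, sigma x y = op x y.
Proof.
case=> _ op_bij x y; have op_inj: injectiveb (finfun (op x)).
  by apply/injectiveP=> u v; rewrite !ffunE; apply: bij_inj.
by rewrite -pvalE val_insubd op_inj ffunE.
Qed.

Definition cycle_set : Prop :=
  [/\ left_quasigroup,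
      forall x y z, op (op x y) (op x z) = op (op y x) (op y z)
    & bijective (fun x => op x x)].

Definition trivial_cycle_set : Prop :=
  exists gamma : {perm X}, forall x y, op x y = gamma y.

(* The product of {perm X} composes from left to right, so it is opposite to
   the composition of Sym(X); the subgroups are the same. *)
Definition perm_group : {group {perm X}} := [group of <<[set sigma x | x : X]>>].

Definition indecomposable : Prop :=
  [transitive perm_group, on [set: X] | 'P].

(* The map sigma_x \o sigma_y^-1 is (sigma y)^-1 * sigma x in {perm X}; the
   subgroup generated by all conjugates is the normal closure. *)
Definition Dis : {group {perm X}} :=
  [group of <<class_support [set (sigma y)^-1 * sigma x | x : X, y : X]
                            perm_group>>].

Definition congruence (R : rel X) : Prop :=
  [/\ equivalence_rel R,
      forall x x' y y', R x x' -> R y y' -> R (op x y) (op x' y')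
    & forall x x' y y', R x x' -> R y y' ->
        R ((sigma x)^-1 y) ((sigma x')^-1 y')].

Definition simple_cycle_set : Prop :=
  [/\ cycle_set, indecomposable
    & forall R : rel X, congruence R ->
        (forall x y, R x y = (x == y)) \/ (forall x y, R x y)].

End CycleSets.

Definition acts_regularly (X : finType) (A : {group {perm X}}) : Prop :=
  [transitive A, on [set: X] | 'P] /\ forall x : X, 'C_A[x | 'P] = 1.

Definition cycle_set_isomorphic (X Y : finType)
    (opX : X -> X -> X) (opY : Y -> Y -> Y) : Prop :=
  exists2 f : X -> Y, bijective f & {morph f : x y / opX x y >-> opY x y}.

Definition invariant_under (gT : finGroupType) (H : {group gT})
    (f : gT -> gT) : Prop :=
  forall x y, x^-1 * y \in H -> (f x)^-1 * f y \in H.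

Definition twisted_op (gT : finGroupType) (phi psi : {perm gT}) (x y : gT) :
  gT := phi x * psi y.

Definition simple_datum (p k : nat) (gT : finGroupType)
    (phi psi : {perm gT}) : Prop :=
  [/\ [/\ prime p, (0 < k)%N & #|gT| = (p ^ k)%N],
      psi \in Aut [set: gT],
      forall x y : gT,
        phi (phi y * psi x) * psi (phi y) = phi (phi x * psi y) * psi (phi x)
    & forall H : {group gT}, H <| [set: gT] -> H :!=: 1 ->
        H :!=: [set: gT] -> invariant_under H psi -> ~ invariant_under H phi].

(* Main.v *)
(* In a finite cycle set the maps s_x : h |-> h sigma_(h x) of Sym(X), where
   products of permutations are read from left to right, commute pairwise.
   Starting from 1 they reach every power of sigma_x, which makes
   squaring surjective, so non-degeneracy is automatic.

   For the twisted operation, the displacements are exactly the left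
   translations of G, so a congruence is the coset partition of a subgroup H.
   The conjugates of all phi(x)^-1 phi(x'), with x^-1 x' in H, lie in H; hence
   phi maps H into one coset of the normal core of H, and H is normal by
   counting.

   Conversely, the maps s_x are invertible and generate an abelian group A (the
   additive group of the brace of G(X)), normalised by left multiplications.
   The orbit of 1 under O_pi(A) is therefore a subgroup, and a Hall subgroup of
   G(X); it contains I = O_pi(Dis(X)).  Comparing s_y and an element of O_pi(A)
   sending 1 to h in I, at the point 1, gives sigma_y^-1 sigma_(h y) in I.  So
   the I-orbits form a congruence, and Dis(X) is a p-group if it is nilpotent.
   Simplicity also makes x |-> sigma_x injective; writing
   sigma_x = t phi(x)^-1 with t in G(X) fixing a base point, and psi for
   conjugation by t, the regular action of Dis(X) identifies X with the twisted cycle set. *)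

Require Import Defs.
From mathcomp Require Import all_boot all_fingroup all_solvable.

Set Implicit Arguments.
Unset Strict Implicit.
Unset Printing Implicit Defensive.

Local Open Scope group_scope.

(** * Equivalence relations and congruences on finite left quasigroups *)

Lemma perm_equiv_inv (X : finType) (R : rel X) (s : {perm X}) :
  (forall x y, R x y -> R (s x) (s y)) ->
  forall x y, R x y -> R (s^-1 x) (s^-1 y).
Proof.
move=> Rs x y Rxy; rewrite invg_expg; elim: _.-1 => [|n IHn].
  by rewrite expg0 !perm1.
by rewrite expgSr !permM; apply: Rs.
Qed.

Lemma equivalence_relE (X : Type) (R : rel X) :
  equivalence_rel R <-> [/\ reflexive R, symmetric R & transitive R].
Proof.
split=> [/equivalence_relP[Rxx Rl]|[Rxx Rsym Rtr]].
  have Rsym : symmetric R.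
    by move=> x y; apply/idP/idP=> /Rl <-; apply: Rxx.
  by split=> // y x z Rxy; rewrite (Rl _ _ Rxy).
apply/equivalence_relP; split=> // x y Rxy z.
by apply/idP/idP; apply: Rtr; rewrite // Rsym.
Qed.

(** By finiteness [(sigma op x)^-1] is a power of [sigma op x] and so preserves [R]; compatibility
    with [op] therefore suffices. *)
Lemma equivalence_congruence (X : finType) (op : X -> X -> X) (R : rel X) :
  left_quasigroup op -> equivalence_rel R ->
  (forall x x' y y', R x x' -> R y y' -> R (op x y) (op x' y')) ->
  congruence op R.
Proof.
move=> lq eqR Rop; split=> // x x' y y' Rxx' Ryy'.
have /equivalence_relE[Rxx Rsym Rtr] := eqR.
have Rsx s t : R s t -> R (sigma op x s) (sigma op x t).
  by rewrite !sigmaE //; apply: Rop.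
set v := (sigma op x')^-1 y'.
have Ryv : R y (sigma op x v).
  apply: (Rtr y') => //; rewrite -[y'](permKV (sigma op x')) -/v !sigmaE //.
  by apply: Rop; rewrite // Rsym.
by have := perm_equiv_inv Rsx Ryv; rewrite permK.
Qed.

Definition lmul (gT : finGroupType) (g : gT) : {perm gT} := perm (mulgI g).

Lemma lmulE (gT : finGroupType) (g x : gT) : lmul g x = g * x.
Proof. exact: permE. Qed.

(** * Commuting shifts and automatic non-degeneracy *)

Section CycleIdentity.

Variables (X : finType) (op : X -> X -> X).
Hypothesis lq : left_quasigroup op.
Hypothesis opC : forall x y z, op (op x y) (op x z) = op (op y x) (op y z).
Local Notation sg := (sigma op).

Lemma sigmaC x y : sg x * sg (sg x y) = sg y * sg (sg y x).
Proof. by apply/permP=> z; rewrite !permM !sigmaE. Qed.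

(* In brace notation, h |-> h + sigma_x. *)
Definition shift (x : X) (h : {perm X}) : {perm X} := h * sg (h x).

Lemma shiftC x y h : shift x (shift y h) = shift y (shift x h).
Proof. by rewrite /shift !permM -!mulgA sigmaC. Qed.

Lemma shift_sigma_exp x n : exists h, shift x h = sg x ^+ n.+1.
Proof.
elim: n => [|n [h hE]]; first by exists 1; rewrite /shift perm1 mul1g expg1.
(* The new index is the preimage of [x] under [sg x ^+ n.+1], so its shift, once moved outside,
   contributes one more factor [sg x]. *)
exists (shift ((sg x ^+ n.+1)^-1 x) h); rewrite shiftC hE /shift permKV.
by rewrite -expgSr.
Qed.

Lemma square_bij : bijective (fun x => op x x).
Proof.
have sqS x : exists y, op y y = x.
  (* The exponent becomes the order of [sg x], so [shift x h = 1]; evaluated at [x], this says that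
     [h x] has square [x]. *)
  have [h] := shift_sigma_exp x #[sg x].-1.
  rewrite prednK // expg_order => hx; exists (h x).
  rewrite -(sigmaE lq) -permM -/(shift x h).
  by rewrite hx perm1.
have [g gK] : exists g, cancel g (fun x => op x x) := fin_all_exists sqS.
have g_bij : bijective g by apply: injF_bij; apply: can_inj gK.
exact: (bij_can_bij g_bij gK).
Qed.

End CycleIdentity.

(** * The additive group generated by the shifts, and its Hall subgroups *)

Section AdditiveGroup.

Variables (X : finType) (op : X -> X -> X).
Hypothesis cs : cycle_set op.
Local Notation sg := (sigma op).
Local Notation G := (perm_group op).

Let lq : left_quasigroup op. Proof. by case: cs. Qed.

(** The value of [shift op x h] at [x] is the square of [h x], so non-degeneracy recovers [h x], and
    then the factor [sg (h x)] cancels. *)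
Lemma shift_inj x : injective (shift op x).
Proof.
have [_ _ /bij_inj sq_inj] := cs.
have sqE h : shift op x h x = op (h x) (h x) by rewrite permM sigmaE.
move=> h h' eq_sh; have eq_x : h x = h' x.
  by apply: sq_inj; rewrite -!sqE eq_sh.
by move: eq_sh; rewrite /shift eq_x => /mulIg.
Qed.

Definition shift_perm x : {perm {perm X}} := perm (@shift_inj x).

Lemma shift_permE x h : shift_perm x h = shift op x h.
Proof. exact: permE. Qed.

Definition shift_group : {group {perm {perm X}}} :=
  [group of <<[set shift_perm x | x : X]>>].

Lemma shift_perm_lmul x g : shift_perm x ^ lmul g = shift_perm (g^-1 x).
Proof.
apply/permP=> h; have lmulK : lmul g (g^-1 * h) = h by rewrite lmulE mulKVg.
rewrite !permM -{1}lmulK permK lmulE !shift_permE /shift.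
by rewrite mulgA mulKVg permM.
Qed.

Lemma shift_group_abelian : abelian shift_group.
Proof.
rewrite /= abelian_gen abelianE.
apply/centsP=> _ /imsetP[x _ ->] _ /imsetP[y _ ->].
by apply/permP=> h; rewrite !permM !permE shiftC //; case: cs.
Qed.

Lemma lmul_norm_shift g : lmul g \in 'N(shift_group).
Proof.
rewrite -sub1set norms_gen // sub1set inE.
apply/subsetP=> _ /imsetP[_ /imsetP[x _ ->] ->].
by rewrite shift_perm_lmul imset_f.
Qed.

Section LmulInvariant.

Variable C : {group {perm {perm X}}}.
Hypothesis nCL : forall g, lmul g \in 'N(C).
Local Notation B := (orbit 'P C 1).

Lemma orbit1P h : reflect (exists2 c, c \in C & h = c 1) (h \in B).
Proof.
by apply: (iffP orbitP) => [[c Cc <-] | [c Cc ->]]; exists c.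
Qed.

Lemma mul_orbit1 (g : {perm X}) (c : {perm {perm X}}) :
  g * c 1 = (c ^ lmul g) g.
Proof.
have lmul1 : lmul g 1 = g by rewrite lmulE mulg1.
by rewrite !permM -[X in (lmul g)^-1 X]lmul1 permK lmulE.
Qed.

(** By [mul_orbit1], [a 1 * b 1] is the image of [1] under [a] followed by a conjugate of [b], which
    [nCL] keeps in [C]. *)
Lemma orbit1_group_set : group_set B.
Proof.
apply/group_setP; split=> [|_ _ /orbit1P[a Ca ->] /orbit1P[b Cb ->]].
  exact: orbit_refl.
apply/orbit1P; exists (a * b ^ lmul (a 1)); last by rewrite permM mul_orbit1.
by rewrite groupM // memJ_norm ?nCL.
Qed.

End LmulInvariant.

Lemma sigma_perm_group x : sg x \in G.
Proof. by rewrite mem_gen ?imset_f. Qed.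

Lemma orbit1_shift_group : orbit 'P shift_group 1 = G.
Proof.
pose B := Group (orbit1_group_set lmul_norm_shift).
apply/eqP; rewrite eqEsubset; apply/andP; split.
  have acts : [acts shift_group, on G | 'P].
    rewrite gen_subG; apply/subsetP=> _ /imsetP[x _ ->].
    rewrite !inE; apply/subsetP=> h Gh; rewrite !inE /= apermE permE.
    by rewrite groupM ?sigma_perm_group.
  by rewrite acts_sub_orbit.
suffices : G \subset B by [].
rewrite gen_subG; apply/subsetP=> _ /imsetP[x _ ->]; apply/orbit1P.
exists (shift_perm x); first by rewrite mem_gen ?imset_f.
by rewrite shift_permE /shift perm1 mul1g.
Qed.

Lemma lmul_norm_pcore (pi : nat_pred) g : lmul g \in 'N('O_pi(shift_group)).
Proof.
rewrite -sub1set (char_norm_trans (pcore_char _ _)) // sub1set.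
exact: lmul_norm_shift.
Qed.

Definition shift_hall (pi : nat_pred) : {group {perm X}} :=
  Group (orbit1_group_set (lmul_norm_pcore pi)).

Lemma shift_hall_pgroup (pi : nat_pred) : pi.-group (shift_hall pi).
Proof. exact: pnat_dvd (dvdn_orbit _ _ _) (pcore_pgroup _ _). Qed.

(** Splitting [c = a * b] along the pi- and pi'-cores of the abelian shift group writes [c 1] as a
    product of points of the two orbits; their coprime orders then multiply to that of [G]. *)
Lemma shift_hall_Hall (pi : nat_pred) : pi.-Hall(G) (shift_hall pi).
Proof.
have sAG (rho : nat_pred) : shift_hall rho \subset G.
  rewrite -orbit1_shift_group; apply/subsetP=> _ /orbit1P[a Aa ->].
  by apply/orbit1P; exists a; rewrite // (subsetP (pcore_sub _ _) _ Aa).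
have defG : shift_hall pi * shift_hall pi^' = G.
  apply/eqP; rewrite eqEsubset mul_subG ?sAG //= -orbit1_shift_group.
  apply/subsetP=> _ /orbit1P[c Ac ->].
  have /dprodP[_ defA _ _] :=
    nilpotent_pcoreC pi (abelian_nil shift_group_abelian).
  move: Ac; rewrite -defA => /mulsgP[a b Aa Ab ->].
  rewrite permM -[b](conjgKV (lmul (a 1))) -mul_orbit1.
  rewrite mem_mulg //; apply/orbit1P; first by exists a.
  exists (b ^ (lmul (a 1))^-1) => //.
  by rewrite memJ_norm // groupV lmul_norm_pcore.
have piB := shift_hall_pgroup pi; have piB' := shift_hall_pgroup pi^'.
rewrite pHallE sAG -defG coprime_cardMg ?(pnat_coprime piB) //.
by rewrite partnM ?cardG_gt0 // part_pnat_id // part_p'nat // muln1 eqxx.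
Qed.

End AdditiveGroup.

(** * Orbit congruences and the cores of the displacement group *)

Section DisplacementGroup.

Variables (X : finType) (op : X -> X -> X).
Local Notation sg := (sigma op).
Local Notation G := (perm_group op).
Local Notation D := (Dis op).

Lemma Dis_normal : D <| G.
Proof.
rewrite /normal norms_gen ?class_support_norm // andbT gen_subG.
apply: class_support_sub_norm (normG _).
apply/subsetP=> _ /imset2P[x y _ _ ->].
by rewrite groupM ?groupV // sigma_perm_group.
Qed.

Lemma Dis_sigma x y : (sg y)^-1 * sg x \in D.
Proof.
rewrite mem_gen // (subsetP (sub_class_support _ _)) //.
by apply/imset2P; exists x y.
Qed.

Lemma normal_orbit_congruence (I : {group {perm X}}) :
  left_quasigroup op -> I <| G ->
  (forall h y, h \in I -> (sg y)^-1 * sg (h y) \in I) ->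
  congruence op (fun x y => y \in orbit 'P I x).
Proof.
move=> lq /andP[_ nIG] sgI.
apply: equivalence_congruence => //.
  apply/equivalence_relE; split=> [x|x y|y x z].
  - exact: orbit_refl.
  - exact: orbit_sym.
  - by move=> xy yz; apply: orbit_trans yz xy.
move=> x _ y _ /orbitP[h Ih <-] /orbitP[g Ig <-].
rewrite -!sigmaE //= /aperm -permM.
(* Moving [g] across [sg x] conjugates it, so the two products differ by an element of [I]. *)
have -> : g * sg (h x) = sg x * (g ^ sg x * ((sg x)^-1 * sg (h x))).
  by rewrite /conjg !mulgA mulgV mul1g mulgK.
rewrite permM; apply: (mem_orbit 'P).
by rewrite groupM ?sgI // memJ_norm // (subsetP nIG) // sigma_perm_group.
Qed.

Lemma pcore_Dis_congruence (pi : nat_pred) :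
  cycle_set op -> nilpotent D ->
  congruence op (fun x y => y \in orbit 'P 'O_pi(D) x).
Proof.
move=> cs nilD; have [lq _ _] := cs.
have nIG : 'O_pi(D) <| G.
  by rewrite (char_normal_trans (pcore_char _ _)) ?Dis_normal.
have hallB := shift_hall_Hall cs pi.
have sIB : 'O_pi(D) \subset shift_hall cs pi.
  apply: subset_trans (pcore_sub_Hall hallB).
  by rewrite pcore_max ?pcore_pgroup.
(* A Hall subgroup of [G] meets the normal subgroup [D] in a Hall subgroup of [D], which is unique
   by nilpotency. *)
have defI : shift_hall cs pi :&: D = 'O_pi(D).
  apply: (eq_Hall_pcore (nilpotent_pcore_Hall pi nilD)).
  exact: Hall_setI_normal Dis_normal hallB.
apply: normal_orbit_congruence => // h y Ih.
suffices : (sg y)^-1 * sg (h y) \in shift_hall cs pi :&: D by rewrite defI.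
rewrite inE Dis_sigma andbT.
have /orbit1P[a Aa ha] := subsetP sIB h Ih.
pose b := (a ^ (lmul (sg y))^-1) 1.
(* Evaluates at [1] the commutation of [a] with the shift by [y]: the left side is
   [shift op y (a 1)], the right side [a (sg y)]. *)
have eq_sh : h * sg (h y) = sg y * b.
  have comm_a : commute (shift_perm cs y) a.
    apply: (centsP (shift_group_abelian cs)); first by rewrite mem_gen ?imset_f.
    exact: subsetP (pcore_sub _ _) _ Aa.
  rewrite mul_orbit1 conjgKV -[h * _]/(shift op y h) -shift_permE ha -permM.
  by rewrite -comm_a permM shift_permE /shift perm1 mul1g.
have Bb : b \in shift_hall cs pi.
  apply/orbit1P; exists (a ^ (lmul (sg y))^-1) => //.
  by rewrite memJ_norm // groupV lmul_norm_pcore.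
have -> : (sg y)^-1 * sg (h y) = (h^-1) ^ sg y * b.
  by rewrite /conjg -!mulgA -eq_sh mulKg.
rewrite groupM // (subsetP sIB) // memJ_norm ?groupV //.
by case/andP: nIG => _ /subsetP-> //; apply: sigma_perm_group.
Qed.

End DisplacementGroup.

(** * The retraction congruence *)

Section Retraction.

Variables (X : finType) (op : X -> X -> X).
Local Notation sg := (sigma op).

(** In [sg x * sg (sg x y) = sg y * sg (sg y x)] the right side depends on [y] only through
    [sg y]. *)
Lemma retraction_congruence :
  cycle_set op -> congruence op (fun x y => sg x == sg y).
Proof.
case=> lq opC _; apply: equivalence_congruence => //.
  apply/equivalence_relE; split=> [x|x y|y x z] //=.
  by move=> /eqP-> /eqP->.
move=> x x' y y' /eqP eqx /eqP eqy; apply/eqP; rewrite -!sigmaE // -eqx.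
by apply: (mulgI (sg x)); rewrite sigmaC // [RHS]sigmaC // eqy.
Qed.

End Retraction.

(** * Twisted operations on a group *)

Section TwistedOperation.

Variables (gT : finGroupType) (phi psi : {perm gT}).
Hypothesis psi_aut : psi \in Aut [set: gT].
Local Notation op := (twisted_op phi psi).

Lemma twistM : {morph psi : x y / x * y}.
Proof. by move=> x y; apply: (morphicP (Aut_morphic psi_aut)); rewrite inE. Qed.

Lemma twisted_left_quasigroup : left_quasigroup op.
Proof.
split=> [|x]; first by apply/card_gt0P; exists 1.
by apply: injF_bij => y z /mulgI/perm_inj.
Qed.

Let lq := twisted_left_quasigroup.

(** The hypothesis is the cycle identity with the common right factor [psi (psi z)] cancelled. *)
Lemma twisted_cycle_set :
  (forall x y, phi (phi y * psi x) * psi (phi y)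
             = phi (phi x * psi y) * psi (phi x)) -> cycle_set op.
Proof.
move=> phiC; have opC x y z : op (op x y) (op x z) = op (op y x) (op y z).
  by rewrite /twisted_op !twistM !mulgA phiC.
by split=> //; apply: square_bij.
Qed.

Lemma twisted_sigmaE x y : sigma op x y = phi x * psi y.
Proof. exact: sigmaE. Qed.

Lemma twisted_displacement x y :
  (sigma op y)^-1 * sigma op x = lmul (phi x * (phi y)^-1).
Proof.
apply: (mulgI (sigma op y)); rewrite mulKVg; apply/permP=> z.
by rewrite permM lmulE !twisted_sigmaE mulgA mulgKV.
Qed.

Lemma lmul_displacement g : exists x y, lmul g = (sigma op y)^-1 * sigma op x.
Proof.
exists (phi^-1 g), (phi^-1 1).
by rewrite twisted_displacement !permKV invg1 mulg1.
Qed.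

Lemma lmul_Dis g : lmul g \in Dis op.
Proof. by have [x [y ->]] := lmul_displacement g; apply: Dis_sigma. Qed.

(** Permutations compose from left to right, so [lmul] reverses products; inverting the argument
    repairs this. *)
Lemma lmulV_morph :
  {in [set: gT] &, {morph (fun g => lmul g^-1) : g h / g * h}}.
Proof.
by move=> g h _ _; apply/permP=> z; rewrite permM !lmulE invMg mulgA.
Qed.

Canonical lmulV_morphism := Morphism lmulV_morph.

Lemma lmul_sigma g x : lmul g ^ sigma op x = lmul (phi x * psi g * (phi x)^-1).
Proof.
apply: (mulgI (sigma op x)); rewrite -conjgC; apply/permP=> z.
by rewrite !permM !lmulE !twisted_sigmaE twistM !mulgA mulgKV.
Qed.

Lemma Dis_twisted : Dis op = lmulV_morphism @* [set: gT] :> {set {perm gT}}.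
Proof.
have lmul_im g : lmul g \in lmulV_morphism @* [set: gT].
  by apply/morphimP; exists g^-1; rewrite ?inE //= invgK.
apply/eqP; rewrite eqEsubset; apply/andP; split; last first.
  by apply/subsetP=> _ /morphimP[g _ _ ->]; apply: lmul_Dis.
rewrite gen_subG; apply: class_support_sub_norm.
  by apply/subsetP=> _ /imset2P[x y _ _ ->]; rewrite twisted_displacement.
rewrite gen_subG; apply/subsetP=> _ /imsetP[x _ ->]; rewrite inE.
apply/subsetP=> _ /imsetP[_ /morphimP[g _ _ ->] ->].
by rewrite /= lmul_sigma.
Qed.

Lemma Dis_twisted_isog : Dis op \isog [set: gT].
Proof.
rewrite isog_sym Dis_twisted sub_isog //; apply/injmP=> g h _ _ /permP/(_ 1).
by rewrite /= !lmulE !mulg1 => /invg_inj.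
Qed.

Lemma twisted_indecomposable : indecomposable op.
Proof.
apply/imsetP; exists 1; rewrite ?inE //; apply/esym/eqP.
rewrite -subTset; apply/subsetP=> x _; apply/orbitP; exists (lmul x).
  by case/andP: (Dis_normal op) => /subsetP-> //; apply: lmul_Dis.
by rewrite /= apermE lmulE mulg1.
Qed.

Lemma twisted_congruence_subgroup (R : rel gT) :
  congruence op R ->
  exists H : {group gT}, [/\ H <| [set: gT], invariant_under H psi,
    invariant_under H phi & forall x y, R x y = (x^-1 * y \in H)].
Proof.
case=> /equivalence_relE[Rxx Rsym Rtr] Rop Rinv.
have Rlmul g x y : R x y -> R (g * x) (g * y).
  move=> Rxy; have [a [b gE]] := lmul_displacement g.
  have mulE z : g * z = sigma op a ((sigma op b)^-1 z).
    by rewrite -permM -gE lmulE.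
  by rewrite !mulE !sigmaE //; apply/Rop/Rinv.
have RE x y : R x y = R 1 (x^-1 * y).
  apply/idP/idP=> [/(Rlmul x^-1)|/(Rlmul x)]; first by rewrite mulVg.
  by rewrite mulg1 mulKVg.
have gH : group_set [set g | R 1 g].
  apply/group_setP; split=> [|a b]; rewrite !inE // => R1a R1b.
  by apply: Rtr R1a _; rewrite RE mulKg.
pose H := Group gH.
have RH x y : R x y = (x^-1 * y \in H) by rewrite inE RE.
(* Multiplying [x] and [y] by the same right factor [psi^-1 w] produces the conjugate by an
   arbitrary [w]. *)
have phiJ x y w : R x y -> ((phi x)^-1 * phi y) ^ w \in H.
  move=> /Rop/(_ (Rxx (psi^-1 w))); rewrite RH /twisted_op permKV.
  by rewrite invMg /conjg !mulgA.
have psiH x y : R x y -> (psi x)^-1 * psi y \in H.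
  by move=> /(Rop _ _ _ _ (Rxx 1)); rewrite RH /twisted_op invMg -mulgA mulKg.
exists H; split=> //.
- have sKH := gcore_sub H [set: gT].
  suffices /eqP <- : gcore H [set: gT] :==: H.
    by rewrite /normal subsetT gcore_norm.
  rewrite eqEcard sKH -(card_imset H (@perm_inj _ phi)).
  rewrite -(card_lcoset (gcore H [set: gT]) (phi 1)) subset_leq_card //.
  apply/subsetP=> _ /imsetP[h Hh ->]; rewrite mem_lcoset.
  apply/bigcapP=> w _; rewrite mem_conjg; apply: phiJ.
  by rewrite RE invg1 mul1g; rewrite inE in Hh.
- by move=> x y xyH; apply: psiH; rewrite RH.
- by move=> x y xyH; rewrite -[_ * _]conjg1; apply: phiJ; rewrite RH.
Qed.

End TwistedOperation.

Lemma simple_datum_twisted (p k : nat) (gT : finGroupType)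
    (phi psi : {perm gT}) :
  simple_datum p k phi psi ->
  [/\ simple_cycle_set (twisted_op phi psi),
      ~ trivial_cycle_set (twisted_op phi psi)
    & Dis (twisted_op phi psi) \isog [set: gT]].
Proof.
case=> [[p_pr k_gt0 cardG] psi_aut phiC noH].
split; last exact: Dis_twisted_isog.
  split; [exact: twisted_cycle_set | exact: twisted_indecomposable |].
  move=> R /twisted_congruence_subgroup[H [nHG psiH phiH RH]].
  have [H1 | ntH] := eqVneq (H : {set gT}) 1; [left | right] => x y; rewrite RH.
    by rewrite H1 inE -eq_mulVg1.
  have [-> | HT] := eqVneq (H : {set gT}) [set: gT]; first by rewrite inE.
  by have := noH H nHG ntH HT psiH.
(* A trivial operation would make the injective map [phi] constant. *)
case=> gamma opE; have : (1 < #|gT|)%N.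
  by rewrite cardG -(exp1n k) ltn_exp2r // prime_gt1.
apply/negP; rewrite -leqNgt; apply/card_le1P => x _ y; rewrite !inE.
apply/esym/eqP/(@perm_inj _ phi)/(mulIg (psi 1)).
by have := opE x 1; rewrite -(opE y 1).
Qed.

(** * Simple cycle sets with regular displacement group *)

Section RegularDisplacement.

Variables (X : finType) (op : X -> X -> X).
Hypotheses (simpX : simple_cycle_set op) (X_gt1 : (1 < #|X|)%N).
Hypothesis regD : acts_regularly (Dis op).
Local Notation sg := (sigma op).
Local Notation D := (Dis op).

Let cs : cycle_set op. Proof. by case: simpX. Qed.

Lemma regular_eq1 d x : d \in D -> d x = x -> d = 1.
Proof.
move=> Dd dx; apply/set1P; rewrite -[[set 1]](regD.2 x) inE Dd.
by apply/astab1P.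
Qed.

Lemma regular_transitive x y : exists2 d, d \in D & y = d x.
Proof. by have /atransP2 := regD.1; apply; rewrite inE. Qed.

Lemma card_regular : #|D| = #|X|.
Proof.
have /imsetP[x _ defX] := regD.1.
by rewrite -(cardsT X) defX card_orbit regD.2 indexg1.
Qed.

(** Otherwise the retraction congruence is total, all displacements are trivial and [D = 1], against
    [#|D| = #|X|]. *)
Lemma simple_sigma_inj : injective sg.
Proof.
have [_ _ /(_ _ (retraction_congruence cs))[sgE x y /eqP|sgE]] := simpX.
  by rewrite sgE => /eqP.
have D1 : D \subset [1 {perm X}].
  rewrite gen_subG; apply: class_support_sub_norm; last exact: norms1.
  apply/subsetP=> _ /imset2P[x y _ _ ->].
  by rewrite (eqP (sgE x y)) mulVg inE.
by have := subset_leq_card D1; rewrite card_regular cards1 leqNgt X_gt1.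
Qed.

(** As [q] divides [#|D|], the [q]-core moves some point; by simplicity it is then transitive, so
    its order is at least [#|X| = #|D|]. *)
Lemma simple_Dis_pgroup : nilpotent D -> (pdiv #|X|).-group D.
Proof.
move=> nilD; set q := pdiv _.
have [_ _ /(_ _ (pcore_Dis_congruence q cs nilD))[eqI|allI]] := simpX.
  have I1 : 'O_q(D) = 1.
    apply/trivgP/subsetP=> h Ih; apply/set1P/permP=> x; rewrite perm1.
    by apply/eqP; rewrite eq_sym -eqI; apply/orbitP; exists h.
  have := card_Hall (nilpotent_pcore_Hall q nilD).
  rewrite /= I1 cards1 card_regular => /esym/eqP.
  by rewrite p_part_eq1 pi_pdiv X_gt1.
have /card_gt0P[x _] : (0 < #|X|)%N := ltnW X_gt1.
have <- : 'O_q(D) = D; last exact: pcore_pgroup.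
apply/eqP; rewrite eqEcard pcore_sub card_regular.
apply: leq_trans (dvdn_leq (cardG_gt0 _) (dvdn_orbit 'P 'O_q(D) x)).
by apply/subset_leq_card/subsetP=> y _; apply: allI.
Qed.

End RegularDisplacement.

(** * Group coordinates from a regular displacement group *)

Section RegularCoordinates.

Variables (X : finType) (op : X -> X -> X).
Hypotheses (cs : cycle_set op) (sgI : injective (sigma op)).
Hypothesis regD : acts_regularly (Dis op).
Variables (x0 : X) (t : {perm X}).
Hypothesis (t_x0 : t x0 = x0).
Hypothesis t_coset : forall x, (sigma op x)^-1 * t \in Dis op.
Local Notation sg := (sigma op).
Local Notation D := (Dis op).
Local Notation gT := (subg_of D).

Let lq : left_quasigroup op. Proof. by case: cs. Qed.

(* Products of permutations are read from left to right, so the inverse turns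
   the right action of D on X into left multiplication. *)
Definition coord_point (u : gT) : X := (val u)^-1 x0.

Lemma coord_point_bij : bijective coord_point.
Proof.
apply: inj_card_bij => [u v eq_uv|].
  apply/val_inj/invg_inj/eqP; rewrite eq_mulgV1; apply/eqP.
  apply: (regular_eq1 regD (x := x0)).
    by rewrite groupM ?groupV ?(valP u) ?(valP v).
  by rewrite permM -[(val u)^-1 x0]/(coord_point u) eq_uv permK.
by have := card_isog (isog_subg D); rewrite cardsT (card_regular regD) => ->.
Qed.

Lemma t_norm : t \in 'N(D).
Proof.
case/andP: (Dis_normal op) => sDG /subsetP nDG; apply: nDG.
by rewrite -[t](mulKVg (sg x0)) groupM ?sigma_perm_group // (subsetP sDG).
Qed.

Lemma subg_valM (u v : gT) : val (u * v) = val u * val v.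
Proof. by []. Qed.

Definition coord_phi_fun (u : gT) : gT := subg D ((sg (coord_point u))^-1 * t).

Definition coord_psi_fun (u : gT) : gT := subg D (val u ^ t).

Lemma val_coord_phi u : val (coord_phi_fun u) = (sg (coord_point u))^-1 * t.
Proof. exact: subgK. Qed.

Lemma val_coord_psi u : val (coord_psi_fun u) = val u ^ t.
Proof. by apply: subgK; rewrite memJ_norm ?t_norm ?(valP u). Qed.

Lemma coord_phi_inj : injective coord_phi_fun.
Proof.
move=> u v /(congr1 val); rewrite !val_coord_phi => /mulIg/invg_inj/sgI.
exact: (bij_inj coord_point_bij).
Qed.

Lemma coord_psi_inj : injective coord_psi_fun.
Proof.
by move=> u v /(congr1 val); rewrite !val_coord_psi => /conjg_inj/val_inj.
Qed.

Definition coord_phi : {perm gT} := perm coord_phi_inj.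
Definition coord_psi : {perm gT} := perm coord_psi_inj.

Lemma coord_psi_aut : coord_psi \in Aut [set: gT].
Proof.
rewrite inE; apply/andP; split; first by apply/subsetP=> u _; rewrite inE.
apply/morphicP=> u v _ _; apply: val_inj; rewrite /= !permE.
by rewrite /= !val_coord_psi conjMg.
Qed.

Lemma coord_morph :
  {morph coord_point : u v / twisted_op coord_phi coord_psi u v >-> op u v}.
Proof.
move=> u v; rewrite /twisted_op [LHS]/coord_point.
rewrite subg_valM [coord_phi u]permE [coord_psi v]permE.
rewrite val_coord_phi val_coord_psi.
(* The leading [t^-1] fixes [x0], which leaves [sg (coord_point u)] applied to [coord_point v]. *)
have -> : ((sg (coord_point u))^-1 * t * val v ^ t)^-1
        = t^-1 * ((val v)^-1 * sg (coord_point u)).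
  by rewrite invMg -conjVg invMg invgK /conjg !mulgA mulgK.
have tV_x0 : t^-1 x0 = x0 by rewrite -{1}t_x0 permK.
by rewrite permM tV_x0 permM sigmaE.
Qed.

Lemma coord_phiC u v :
  coord_phi (coord_phi v * coord_psi u) * coord_psi (coord_phi v)
  = coord_phi (coord_phi u * coord_psi v) * coord_psi (coord_phi u).
Proof.
have [_ opC _] := cs.
(* In this form the symmetry in [a] and [b] is exactly [sigmaC]. *)
suffices valE a b : val (coord_phi (coord_phi a * coord_psi b)
    * coord_psi (coord_phi a))
    = (sg (coord_point a) * sg (sg (coord_point a) (coord_point b)))^-1
      * (t * t).
  by apply: val_inj; rewrite !valE sigmaC.
rewrite subg_valM ![coord_phi (_ * _)]permE.
rewrite [coord_psi (coord_phi a)]permE val_coord_psi val_coord_phi.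
rewrite -/(twisted_op _ _ a b) coord_morph [coord_phi a]permE val_coord_phi.
by rewrite sigmaE // /conjg invMg !mulgA mulgK.
Qed.

Lemma coord_subgroup_congruence (H : {group gT}) (g : X -> gT) :
    cancel g coord_point -> H <| [set: gT] ->
    invariant_under H coord_psi -> invariant_under H coord_phi ->
  congruence op (fun x y => (g x)^-1 * g y \in H).
Proof.
move=> gK /andP[_ nH] psiH phiH.
have coordK : cancel coord_point g.
  by move=> u; apply: (bij_inj coord_point_bij); rewrite gK.
apply: equivalence_congruence => //.
  apply/equivalence_relE; split=> [x|x y|y x z] /=.
  - by rewrite mulVg group1.
  - by rewrite -groupV invMg invgK.
  - by move=> xy yz; rewrite -(mulgK (g y) (g x)^-1) -mulgA groupM.
have g_op x y : g (op x y) = coord_phi (g x) * coord_psi (g y).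
  by rewrite -{1}[x]gK -{1}[y]gK -coord_morph coordK.
move=> x x' y y' Hx Hy; rewrite !g_op.
set a := coord_phi _; set b := coord_psi _.
set c := coord_phi _; set d := coord_psi _.
(* Normality of [H] absorbs the conjugation by [b]. *)
have -> : (a * b)^-1 * (c * d) = (a^-1 * c) ^ b * (b^-1 * d).
  by rewrite invMg /conjg !mulgA mulgK.
rewrite groupM //; last exact: psiH.
by rewrite memJ_norm ?(subsetP nH) ?inE //; apply: phiH.
Qed.

End RegularCoordinates.

Lemma simple_regular_datum (X : finType) (op : X -> X -> X) :
  simple_cycle_set op -> (1 < #|X|)%N ->
  nilpotent (Dis op) -> acts_regularly (Dis op) ->
  exists (p k : nat) (gT : finGroupType) (phi psi : {perm gT}),
    simple_datum p k phi psi /\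
    cycle_set_isomorphic op (twisted_op phi psi).
Proof.
move=> simpX X_gt1 nilD regD; have [cs _ congrX] := simpX.
have sgI := simple_sigma_inj simpX X_gt1 regD.
have /card_gt0P[x0 _] : (0 < #|X|)%N := ltnW X_gt1.
(* Transitivity of the displacement group corrects [sigma op x0], within its coset, to an element
   fixing [x0]. *)
have [d Dd x0E] := regular_transitive regD (sigma op x0 x0) x0.
pose t := sigma op x0 * d.
have t_x0 : t x0 = x0 by rewrite permM.
have t_coset x : (sigma op x)^-1 * t \in Dis op.
  by rewrite mulgA groupM // Dis_sigma.
have [q [q_pr q_dvd qD]] :
    exists q, [/\ prime q, (q %| #|X|)%N & q.-group (Dis op)].
  exists (pdiv #|X|); rewrite pdiv_prime // pdiv_dvd.
  by split=> //; apply: simple_Dis_pgroup.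
have cardD : #|subg_of (Dis op)| = #|X|.
  exact: bij_eq_card (coord_point_bij regD x0).
have [g coordK gK] := coord_point_bij regD x0.
exists q, (logn q #|Dis op|), (subg_of (Dis op)).
exists (coord_phi sgI regD x0 t_coset), (coord_psi x0 t_coset).
split; last first.
  exists g; first exact: Bijective gK coordK.
  move=> x y; apply: (can_inj coordK).
  by rewrite coord_morph // !gK.
split.
- split=> //; last by rewrite -(card_pgroup qD) (card_regular regD).
  by rewrite (card_regular regD) logn_gt0 mem_primes q_pr q_dvd ltnW.
- exact: coord_psi_aut.
- exact: coord_phiC.
move=> H nH /eqP ntH /eqP HT psiH phiH.
have congrH := coord_subgroup_congruence cs t_x0 gK nH psiH phiH.
(* The class of the base point corresponds to [H], so equality gives [H = 1] and the total relation
   gives the whole group. *)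
case: (congrX _ congrH) => /(_ (coord_point x0 (1 : subg_of (Dis op)))) RH.
  apply: ntH; apply/trivgP/subsetP=> u Hu; apply/set1P.
  move: (RH (coord_point x0 u)).
  rewrite !coordK invg1 mul1g Hu => /esym/eqP eq1u.
  by rewrite -[u]coordK -eq1u coordK.
apply/HT/setP=> u; move: (RH (coord_point x0 u)).
by rewrite !coordK invg1 mul1g inE => ->.
Qed.

Theorem theorem44 :
  (forall (p k : nat) (gT : finGroupType) (phi psi : {perm gT}),
     simple_datum p k phi psi ->
     [/\ simple_cycle_set (twisted_op phi psi),
         ~ trivial_cycle_set (twisted_op phi psi)
       & Dis (twisted_op phi psi) \isog [set: gT]])
  /\
  (forall (X : finType) (op : X -> X -> X),
     simple_cycle_set op -> (1 < #|X|)%N ->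
     nilpotent (Dis op) -> acts_regularly (Dis op) ->
     exists (p k : nat) (gT : finGroupType) (phi psi : {perm gT}),
       simple_datum p k phi psi /\
       cycle_set_isomorphic op (twisted_op phi psi)).
Proof.
by split; [exact: simple_datum_twisted | exact: simple_regular_datum].
Qed.
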